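(* (i) For all integers $k,m\ge0$ with $(k,m)\neq(0,0)$ and all real $x$, $$\frac{d^m\sin^kx}{dx^m}=\frac{(-1)^k}{2^k}\sum_{q=0}^k(-1)^q\binom{k}{q}(2q-k)^m\cos\Bigl[(m-k)\frac\pi2+(2q-k)x\Bigr],$$ $$\frac{d^m\cos^kx}{dx^m}=\frac1{2^k}\sum_{q=0}^k\binom{k}{q}(2q-k)^m\cos\Bigl[\frac{\pi}2m+(2q-k)x\Bigr],$$ $$\sum_{q=0}^k(-1)^q\binom{k}{q}(2q-k)^m\sin\Bigl[(m-k)\frac\pi2+(2q-k)x\Bigr]=0,$$ $$\sum_{q=0}^k\binom{k}{q}(2q-k)^m\sin\Bigl[\frac{\pi}2m+(2q-k)x\Bigr]=0.$$ (ii) For all integers $m\ge k\ge1$, the Bell polynomials of the second kind $\mathrm{B}_{m,k}$ satisfy, for real $x$ with $\cos x\ne0$, $$\mathrm{B}_{m,k}\Bigl(-\sin x,-\cos x,\sin x,\cos x,\dotsc,-\sin\Bigl[x+(m-k)\frac{\pi}{2}\Bigr]\Bigr)=\frac{(-1)^k}{k!}\cos^kx\sum_{\ell=0}^k\frac{(-1)^\ell}{2^\ell}\binom{k}{\ell}\frac1{\cos^{\ell}x}\sum_{q=0}^\ell\binom{\ell}{q}(2q-\ell)^m\cos\Bigl[\frac{\pi}2m+(2q-\ell)x\Bigr],$$ and, for real $x$ with $\sin x\neq0$, $$\mathrm{B}_{m,k}\Bigl(\cos x,-\sin x,-\cos x,\sin x,\dotsc,\cos\Bigl[x+(m-k)\frac{\pi}{2}\Bigr]\Bigr)=\frac{(-1)^k}{k!}\sin^{k}x\sum_{\ell=0}^k\frac1{2^\ell}\binom{k}{\ell}\frac1{\sin^{\ell}x}\sum_{q=0}^\ell(-1)^q\binom{\ell}{q}(2q-\ell)^m\cos\Bigl[(m-\ell)\frac\pi2+(2q-\ell)x\Bigr].$$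 Here the $j$-th argument ($1\le j\le m-k+1$) of $\mathrm{B}_{m,k}$ is $\cos\bigl(x+j\frac\pi2\bigr)$ in the first identity and $\sin\bigl(x+j\frac\pi2\bigr)$ in the second. (iii) For every $n\in\mathbb{N}=\{1,2,\dots\}$, for real $x$ with $\cos x\neq0$, $$\frac{d^n\tan x}{dx^n}=-\sum_{k=1}^{n+1}\frac1{k}\sum_{\ell=0}^k\frac{(-1)^\ell}{2^\ell}\binom{k}{\ell}\frac1{\cos^{\ell}x}\sum_{q=0}^\ell\binom{\ell}{q}(2q-\ell)^{n+1}\sin\Bigl[\frac{\pi}2n+(2q-\ell)x\Bigr],$$ and for real $x$ with $\sin x\neq0$, $$\frac{d^n\cot x}{dx^n}=\sum_{k=1}^{n+1}\frac1k\sum_{\ell=0}^k\frac1{2^\ell}\binom{k}{\ell}\frac1{\sin^{\ell}x}\sum_{q=0}^\ell(-1)^q\binom{\ell}{q}(2q-\ell)^{n+1}\sin\Bigl[(n-\ell)\frac\pi2+(2q-\ell)x\Bigr].$$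
   Context: The Bell polynomials of the second kind (partial Bell polynomials) are defined for $n\ge k\ge0$ by $$\mathrm{B}_{n,k}(x_1,x_2,\dotsc,x_{n-k+1})=\sum\frac{n!}{\prod_{q=1}^{n-k+1}\ell_q!}\prod_{q=1}^{n-k+1}\Bigl(\frac{x_q}{q!}\Bigr)^{\ell_q},$$ where the sum runs over all nonnegative integers $\ell_1,\ell_2,\dots,\ell_{n-k+1}$ with $\sum_{q}q\,\ell_q=n$ and $\sum_{q}\ell_q=k$. The convention $0^0=1$ is used (relevant in (i) when $m=0$ and $2q=k$); the zeroth derivative of a function is the function itself. *)

(* Defs.v *)
From HB Require Import structures.
From mathcomp Require Import all_boot all_order all_algebra.
From mathcomp Require Import all_classical all_reals all_analysis.

Set Implicit Arguments.
Unset Strict Implicit.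
Unset Printing Implicit Defensive.

Import Order.TTheory GRing.Theory Num.Theory.
Import numFieldNormedType.Exports.

Local Open Scope classical_set_scope.
Local Open Scope ring_scope.

(* B_{n,k}(x 1, ..., x (n - k + 1)) for k <= n. The variables are given as a
   sequence indexed from 1. The ordinal q stands for the index q + 1, so that
   l q is the exponent l_{q+1}; bounding l q by n loses nothing, since
   \sum_q (q + 1) l_{q+1} = n forces l_{q+1} <= n. *)
Definition bell (F : numFieldType) (n k : nat) (x : nat -> F) : F :=
  \sum_(l : {ffun 'I_(n - k + 1) -> 'I_n.+1} |
          (\sum_(q < n - k + 1) q.+1 * l q == n)%N &&
          (\sum_(q < n - k + 1) l q == k)%N)
     (n`!)%:R / (\prod_(q < n - k + 1) ((l q)`!)%:R) *
     \prod_(q < n - k + 1) (x q.+1 / (q.+1`!)%:R) ^+ l q.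

(* f has an n-th derivative at x and its value is d. The library's f^`(n) is
   total, with a junk value where f is not differentiable, hence the explicit
   differentiability conditions. *)
Definition is_nderive (R : realType) (f : R -> R) (n : nat) (x d : R) : Prop :=
  if n is p.+1 then
    (\forall y \near x, forall i, (i < p)%N -> derivable (f^`(i)%classic) y 1) /\
    is_derive x 1 (f^`(p)%classic) d
  else f x = d.

Definition cot (R : realType) (x : R) : R := cos x / sin x.

(* Main.v *)
(* Taylor polynomials of cosine at x: the product formula for cosines and
   Pascal's rule show that the explicit sums for (cos^l)^(m) satisfy Leibniz'
   rule for cos^l * cos. Hence they are, up to m!, the coefficients of the
   powers T^l, where T = \sum_j cos(x + j pi/2) X^j / j!; no differentiation is
   needed for this. By the multinomial theorem, B_{m,k} is m!/k! times the
   coefficient of X^m in (T - cos x)^k, and the binomial expansion of that power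
   gives (ii).
   For (iii), put K_{m,k} = (-1)^k k! cos^{-k} B_{m,k}. Then
     (K_{m,k} / k)' = K_{m+1,k} / k + tan * (K_{m,k} - K_{m,k-1}),
   so \sum_{k <= n} K_{m,k} / k, which is tan for m = 1, is differentiated by
   m -> m + 1: the second terms telescope to 0 because K_{m,n} = 0 for m < n and
   K_{m,0} = 0 for m > 0.
   All the sine and cotangent formulas follow by the translation x -> x - pi/2. *)
Require Import Defs.
From HB Require Import structures.
From mathcomp Require Import all_boot all_order all_algebra.
From mathcomp Require Import all_classical all_reals all_analysis.
From mathcomp Require Import ring lra.

Set Implicit Arguments.
Unset Strict Implicit.
Unset Printing Implicit Defensive.

Import Order.TTheory GRing.Theory Num.Theory.
Import numFieldNormedType.Exports.

Local Open Scope classical_set_scope.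
Local Open Scope ring_scope.

(** * Divided powers and the multinomial theorem *)

Lemma natr_fact_neq0 (F : numFieldType) n : n`!%:R != 0 :> F.
Proof. by rewrite pnatr_eq0 -lt0n fact_gt0. Qed.

Lemma natr_bin_fact (F : numFieldType) n m : (m <= n)%N ->
  'C(n, m)%:R / n`!%:R = m`!%:R^-1 * (n - m)`!%:R^-1 :> F.
Proof.
move=> le_mn; rewrite -(bin_fact le_mn) !natrM.
have := natr_fact_neq0 F m; have := natr_fact_neq0 F (n - m).
have : 'C(n, m)%:R != 0 :> F by rewrite pnatr_eq0 -lt0n bin_gt0.
by move=> ? ? ?; field; apply/and3P; split.
Qed.

Section DividedPowers.
Variable F : numFieldType.

(** The binomial theorem as a Cauchy product: dividing powers by factorials absorbs the binomial
    coefficients. *)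
Lemma divided_powerD (A : comAlgType F) (a b : A) k :
  \sum_(j < k.+1) (j`!%:R^-1 *: a ^+ j) * ((k - j)`!%:R^-1 *: b ^+ (k - j)) =
  k`!%:R^-1 *: (a + b) ^+ k.
Proof.
rewrite addrC exprDn scaler_sumr; apply: eq_bigr => j _.
have le_jk : (j <= k)%N by rewrite -ltnS.
rewrite -scalerAl -scalerAr scalerA -natr_bin_fact // -scalerMnr scalerMnl.
by rewrite mulr_natl [b ^+ _ * _]mulrC.
Qed.

Variables (N n : nat) (a : 'I_N -> {poly F}).

(** The exponential of [a q] times an auxiliary outer variable that counts exponents, exact up to
    degree [n]. *)
Let expTrunc (q : 'I_N) : {poly {poly F}} :=
  \poly_(j < n.+1) (j`!%:R^-1 *: a q ^+ j).

Let coef_prod_expTrunc (r : seq 'I_N) k : (k <= n)%N ->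
  (\prod_(q <- r) expTrunc q)`_k = k`!%:R^-1 *: (\sum_(q <- r) a q) ^+ k.
Proof.
elim: r k => [|q r IHr] k le_kn.
  by rewrite !big_nil coef1 expr0n; case: k le_kn => [|k] _; rewrite ?invr1 ?scale1r ?scaler0.
rewrite !big_cons coefM -divided_powerD; apply: eq_bigr => j _.
have le_jk : (j <= k)%N by rewrite -ltnS.
rewrite coef_poly ltnS (leq_trans le_jk) // IHr //.
exact: leq_trans (leq_subr _ _) le_kn.
Qed.

(** Both sides are the coefficient of degree [k] in the product of the truncated exponentials: the
    right one since exponentials multiply by adding exponents, the left one by distributing the
    product over all choices of [l]. *)
Lemma multinomial_divided_power k : (k <= n)%N ->
  \sum_(l : {ffun 'I_N -> 'I_n.+1} | (\sum_q l q == k)%N)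
    \prod_q ((l q)`!%:R^-1 *: a q ^+ l q) =
  k`!%:R^-1 *: (\sum_q a q) ^+ k.
Proof.
move=> le_kn; rewrite -coef_prod_expTrunc //.
under [X in _ = (polyseq X)`_k]eq_bigr do rewrite /expTrunc poly_def.
rewrite bigA_distr_bigA coef_sum big_mkcond; apply: eq_bigr => l _ /=.
rewrite [in RHS]scaler_prod -expr_sum coefZ coefXn eq_sym.
by case: eqP => _; rewrite ?mulr1 ?mulr0.
Qed.

End DividedPowers.

(** * Bell polynomials as coefficients of powers *)

(** The multinomial theorem accounts for the condition that the [l q] sum to [k]; taking the
    coefficient of ['X^n] selects the weight [n]. As [k <= n], the bound [n] on the exponents cuts
    nothing off. *)
Lemma bell_coef (F : numFieldType) (n k : nat) (x : nat -> F) : (k <= n)%N ->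
  bell n k x = n`!%:R / k`!%:R *
    ((\sum_(q < n - k + 1) (x q.+1 / q.+1`!%:R) *: 'X^(q.+1)) ^+ k)`_n.
Proof.
move=> le_kn; rewrite -mulrA -coefZ -(multinomial_divided_power _ le_kn).
rewrite coef_sum mulr_sumr /bell big_mkcondl; apply: eq_bigr => l _ /=.
under [X in (polyseq X)`_n]eq_bigr do rewrite exprZn scalerA -exprM.
rewrite [in RHS]scaler_prod -expr_sum coefZ coefXn eq_sym.
case: eqP => _; last by rewrite !mulr0.
by rewrite mulr1 -mulrA big_split /= -prodfV.
Qed.

(** Products never involve coefficients above the degree read off. This allows a change of
    truncation order. *)
Lemma coef_expr_agree (A : nzRingType) (p q : {poly A}) n k :
  (forall i, (i <= n)%N -> p`_i = q`_i) -> (p ^+ k)`_n = (q ^+ k)`_n.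
Proof.
elim: k n => [|k IHk] n pq; first by rewrite !expr0.
rewrite !exprS !coefM; apply: eq_bigr => i _.
have le_in : (i <= n)%N by rewrite -ltnS.
rewrite pq // IHk // => j le_j; apply: pq.
exact: leq_trans le_j (leq_subr _ _).
Qed.

(** * Higher derivatives from a family of functions *)

Section SmoothFamilies.
Variable R : realType.

Lemma is_derive_sum_seq (I : Type) (r : seq I) (h dh : I -> R -> R) (x : R) :
  (forall i, is_derive x 1 (h i) (dh i x)) ->
  is_derive x 1 (fun t => \sum_(i <- r) h i t) (\sum_(i <- r) dh i x).
Proof.
move=> dh_i; elim: r => [|i r IHr].
  rewrite big_nil; under eq_fun do rewrite big_nil.
  exact: is_derive_cst.
rewrite big_cons; under eq_fun do rewrite big_cons.
exact: is_deriveD.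
Qed.

Lemma is_derive_translate (f : R -> R) (a x d : R) :
  is_derive (x - a) 1 f d -> is_derive x 1 (fun t => f (t - a)) d.
Proof.
move=> df; have := @is_derive1_comp R f (shift (- a)) x d 1 df (is_derive_shift x 1 (- a)).
by rewrite mulr1.
Qed.

(** By induction the i-th derivative of [f] is [F i] on all of [U]. Since [U] is open, this equality
    holds near each of its points, which is what transfers derivability and the next derivative. *)
Lemma is_nderive_family (U : set R) (f : R -> R) (F : nat -> R -> R) n (x : R) :
  open U -> U x -> (forall y, U y -> f y = F 0%N y) ->
  (forall i y, (i < n)%N -> U y -> is_derive y 1 (F i) (F i.+1 y)) ->
  is_nderive f n x (F n x).
Proof.
move=> oU Ux fF dF.
have nearU y : U y -> \forall z \near y, U z by move=> Uy; apply: open_nbhs_nbhs.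
have dfE i y : (i <= n)%N -> U y -> f^`(i)%classic y = F i y.
  elim: i y => [|i IHi] y lt_in Uy; first exact: fF.
  rewrite derive1nS derive1E (near_eq_derive _ (g := F i)).
    by have /@derive_val := dF i y lt_in Uy.
  by near=> z; apply: IHi; [exact: ltnW | near: z; exact: nearU].
have dfn i y : (i < n)%N -> U y -> is_derive y 1 (f^`(i)%classic) (F i.+1 y).
  move=> lt_in Uy; have dFi := dF i y lt_in Uy.
  have eqF : \forall z \near y, F i z = f^`(i)%classic z.
    by near=> z; rewrite dfE ?(ltnW lt_in) //; near: z; exact: nearU.
  apply: DeriveDef; first by apply: near_eq_derivable eqF _; exact: ex_derive.
  by rewrite -(near_eq_derive _ eqF) derive_val.
case: n dF dfE dfn => [|p] dF dfE dfn /=; first exact: fF.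
split; last exact: dfn.
near=> y; move=> i lt_ip; have Uy : U y by near: y; exact: nearU.
by apply: ex_derive; apply: dfn; rewrite // ltnS ltnW.
Unshelve. all: by end_near. Qed.

End SmoothFamilies.

(** Pascal's rule under a sum. *)
Lemma sum_binS (V : comNzRingType) n (h : nat -> V) :
  \sum_(0 <= q < n.+2) 'C(n.+1, q)%:R * h q =
  \sum_(0 <= q < n.+1) 'C(n, q)%:R * (h q.+1 + h q).
Proof.
rewrite big_nat_recl //= bin0 mul1r.
under eq_bigr do rewrite binS natrD mulrDl.
rewrite big_split /= addrA [in RHS](eq_bigr _ (fun _ _ => mulrDr _ _ _)).
rewrite [in RHS]big_split /= addrC; congr (_ + _).
rewrite big_nat_recr //= bin_small // mul0r addr0 [in RHS]big_nat_recl //=.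
by rewrite bin0 mul1r.
Qed.

(** * Explicit sums for the derivatives of powers of cosine *)

Section CosinePowers.
Variable R : realType.
Implicit Types (a x y : R) (k l m n : nat).

Lemma cosDpin x n : cos (x + n%:R * pi) = (-1) ^+ n * cos x.
Proof. by rewrite mulr_natl (alternatingn (@cosDpi R)). Qed.

Lemma sinDpin x n : sin (x + n%:R * pi) = (-1) ^+ n * sin x.
Proof. by rewrite mulr_natl (alternatingn (@sinDpi R)). Qed.

Lemma cosMcos x y : cos x * cos y = (cos (x + y) + cos (x - y)) / 2.
Proof. by rewrite cosD cosB; field. Qed.

(* The m-th derivative of cos (a x). *)
Let jet a m x := a ^+ m * cos (pi / 2 * m%:R + a * x).

(** Leibniz' rule for cos (a x) cos x, termwise: expand (a + 1)^m and (a - 1)^m binomially and apply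
    the product formula for cosines. *)
Let jet_leibniz a m x :
  \sum_(j < m.+1) 'C(m, j)%:R * jet a j x * cos (x + (m - j)%:R * (pi / 2)) =
  (jet (a + 1) m x + jet (a - 1) m x) / 2.
Proof.
rewrite /jet (addrC a 1) (addrC a (- 1)) 2!exprDn !mulr_suml -big_split mulr_suml.
apply: eq_bigr => j _ /=; have le_jm : (j <= m)%N by rewrite -ltnS.
rewrite mulrA -mulrA cosMcos expr1n mul1r.
have -> : pi / 2 * m%:R + (1 + a) * x =
    pi / 2 * j%:R + a * x + (x + (m - j)%:R * (pi / 2)).
  by rewrite natrB //; field.
(* The extra (m - j) pi produces a sign that cancels the (-1)^(m - j) from the expansion of (a -
   1)^m. *)
have -> : pi / 2 * m%:R + (-1 + a) * x =
    pi / 2 * j%:R + a * x - (x + (m - j)%:R * (pi / 2)) + (m - j)%:R * pi.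
  by rewrite natrB //; field.
rewrite cosDpin.
have sgn2 : (-1) ^+ (m - j) * (-1) ^+ (m - j) = 1 :> R.
  by rewrite -expr2 sqrr_sign.
ring: sgn2.
Qed.

Let is_derive_jet a m x : is_derive x 1 (jet a m) (jet a m.+1 x).
Proof.
have dlin : is_derive x 1 (fun t : R => pi / 2 * m%:R + a * t) a.
  have := is_deriveD (is_derive_cst (pi / 2 * m%:R : R) x 1)
    (is_deriveZ a (is_derive_id x 1)).
  by rewrite add0r /GRing.scale /= mulr1.
have := is_deriveZ (a ^+ m) (@is_derive1_comp R cos _ x _ a (is_derive_cos _) dlin).
move=> /is_derive_eq; apply; rewrite /jet /GRing.scale /=.
have -> : pi / 2 * m.+1%:R + a * x = pi / 2 * m%:R + a * x + pi / 2.
  by rewrite -natr1; ring.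
by rewrite cosDpihalf exprS; ring.
Qed.

(** This is 2^l times the m-th derivative of cos^l; the frequencies 2q - l are those of (e^(ix) +
    e^(-ix))^l. *)
Definition cosSum l m x :=
  \sum_(0 <= q < l.+1) 'C(l, q)%:R * (2 * q%:R - l%:R) ^+ m *
    cos (pi / 2 * m%:R + (2 * q%:R - l%:R) * x).

Definition cosPow l m x := 1 / 2 ^+ l * cosSum l m x.

Let cosSum_jet l m x :
  cosSum l m x = \sum_(0 <= q < l.+1) 'C(l, q)%:R * jet (2 * q%:R - l%:R) m x.
Proof. by apply: eq_bigr => q _; rewrite -mulrA. Qed.

Lemma is_derive_cosPow l m x : is_derive x 1 (cosPow l m) (cosPow l m.+1 x).
Proof.
have dsum : is_derive x 1 (cosSum l m) (cosSum l m.+1 x).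
  rewrite (_ : cosSum l m = fun t => \sum_(0 <= q < l.+1)
      'C(l, q)%:R * jet (2 * q%:R - l%:R) m t).
    rewrite cosSum_jet; apply: (@is_derive_sum_seq _ _ _ _ (fun q t =>
      'C(l, q)%:R * jet (2 * q%:R - l%:R) m.+1 t)) => q.
    exact: is_deriveZ.
  by apply/funext => t; exact: cosSum_jet.
exact: is_deriveZ.
Qed.

(** Pascal's rule splits the sum for [l.+1] into two sums over the frequencies of [l], shifted by 1
    and by -1; [jet_leibniz] recombines them. *)
Lemma cosPow_leibniz l m x :
  cosPow l.+1 m x =
  \sum_(j < m.+1) 'C(m, j)%:R * cosPow l j x * cos (x + (m - j)%:R * (pi / 2)).
Proof.
rewrite /cosPow cosSum_jet sum_binS.
transitivity (1 / 2 ^+ l * \sum_(0 <= q < l.+1) 'C(l, q)%:R *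
    \sum_(j < m.+1) 'C(m, j)%:R * jet (2 * q%:R - l%:R) j x *
      cos (x + (m - j)%:R * (pi / 2))).
  rewrite !mulr_sumr; apply: eq_bigr => q _; rewrite jet_leibniz.
  have -> : 2 * q.+1%:R - l.+1%:R = 2 * q%:R - l%:R + 1 :> R.
    by rewrite -!natr1; ring.
  have -> : 2 * q%:R - l.+1%:R = 2 * q%:R - l%:R - 1 :> R.
    by rewrite -!natr1; ring.
  by rewrite exprS; field; rewrite expf_neq0 // pnatr_eq0.
under eq_bigr do rewrite mulr_sumr.
rewrite exchange_big mulr_sumr; apply: eq_bigr => j _ /=.
rewrite cosSum_jet !(mulr_sumr, mulr_suml); apply: eq_bigr => q _.
by ring.
Qed.

(** The only frequency is 0, so the value at [m = 0] rests on 0^0 = 1. *)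
Lemma cosPow0 m x : cosPow 0 m x = (m == 0%N)%:R.
Proof.
rewrite /cosPow /cosSum big_nat1 bin0 mulr0 subr0 mul0r addr0 expr0 divr1 !mul1r.
by case: m => [|m]; rewrite ?mulr0 ?cos0 ?mulr1 // expr0n mul0r.
Qed.

Lemma cosPow_expr l x : cosPow l 0 x = cos x ^+ l.
Proof.
elim: l => [|l IHl]; first by rewrite cosPow0.
by rewrite cosPow_leibniz big_ord1 bin0 mul1r IHl subnn mul0r addr0 exprSr.
Qed.

(** The reflection q -> l - q negates the frequency. The power and the sine each contribute (-1)^m,
    and oddness of the sine leaves one minus sign, so the sum is its own negative. *)
Lemma sinSum_eq0 l m x :
  \sum_(0 <= q < l.+1) 'C(l, q)%:R * (2 * q%:R - l%:R) ^+ m *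
    sin (pi / 2 * m%:R + (2 * q%:R - l%:R) * x) = 0.
Proof.
set s := LHS; suff : s = - s by lra.
rewrite {1}/s big_nat_rev /= add0n -sumrN; apply: eq_big_nat => q /andP[_ lt_ql].
rewrite subSS bin_sub // natrB //.
have -> : 2 * (l%:R - q%:R) - l%:R = - (2 * q%:R - l%:R) :> R by ring.
rewrite exprNn mulNr.
have -> : pi / 2 * m%:R - (2 * q%:R - l%:R) * x =
    - (pi / 2 * m%:R + (2 * q%:R - l%:R) * x) + m%:R * pi by field.
rewrite sinDpin sinN.
have sgn2 : (-1) ^+ m * (-1) ^+ m = 1 :> R by rewrite -expr2 sqrr_sign.
ring: sgn2.
Qed.

End CosinePowers.

(** * Bell polynomials at the derivatives of cosine *)

Section BellCosine.
Variable R : realType.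
Implicit Types (x : R) (k l m n : nat).

Definition cosTaylor m x : {poly R} :=
  \poly_(j < m.+1) (cos (x + j%:R * (pi / 2)) / j`!%:R).

(** After division by factorials, [cosPow_leibniz] is the Cauchy product for one more factor T. *)
Lemma coef_cosTaylor_expr l m j x : (j <= m)%N ->
  (cosTaylor m x ^+ l)`_j = cosPow l j x / j`!%:R.
Proof.
elim: l j => [|l IHl] j le_jm.
  rewrite cosPow0 expr0 coef1; case: j le_jm => [|j] _; last by rewrite mul0r.
  by rewrite divr1.
rewrite exprSr coefM cosPow_leibniz mulr_suml; apply: eq_bigr => i _.
have le_ij : (i <= j)%N by rewrite -ltnS.
rewrite IHl ?(leq_trans le_ij) // coef_poly ltnS (leq_trans (leq_subr _ _)) //.
transitivity ('C(j, i)%:R / j`!%:R *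
  (cosPow l i x * cos (x + (j - i)%:R * (pi / 2)))); last by ring.
by rewrite natr_bin_fact //; ring.
Qed.

(* This is K_{m,k}, that is, (-1)^k k! cos^{-k} B_{m,k}. *)
Definition diffSum k m x :=
  \sum_(0 <= l < k.+1) (-1) ^+ l / 2 ^+ l * 'C(k, l)%:R *
    (1 / cos x ^+ l) * cosSum l m x.

(** This is (T - cos x) / X, truncated; taking X out makes the order of vanishing of (T - cos x)^k
    visible. *)
Definition cosTail n x : {poly R} :=
  \poly_(q < n) (cos (x + q.+1%:R * (pi / 2)) / q.+1`!%:R).

(** Since - (T - cos x) / cos x = 1 - T / cos x, the binomial expansion of the k-th power has the
    terms of [diffSum] as coefficients, up to m!. *)
Lemma diffSum_coef k m x : cos x != 0 ->
  diffSum k m x = m`!%:R * (- (cos x)^-1) ^+ k * ('X^k * cosTail m x ^+ k)`_m.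
Proof.
move=> c0; rewrite -mulrA.
rewrite -exprMn -coefZ -exprZn.
have -> : - (cos x)^-1 *: ('X * cosTail m x) = 1 - (cos x)^-1 *: cosTaylor m x.
  apply/polyP => -[|i]; rewrite !(coefZ, coefXM, coefB, coef1, coef_poly) /=.
    by rewrite mul0r addr0 divr1 mulr0 mulVf ?subrr.
  by rewrite ltnS; case: ifP => _; rewrite ?mulr0 ?subr0 // sub0r mulNr.
rewrite exprBn coef_sum mulr_sumr /diffSum big_mkord; apply: eq_bigr => l _.
rewrite expr1n mulr1 exprZn.
have -> : (-1) ^+ l * ((cos x)^-1 ^+ l *: cosTaylor m x ^+ l) =
    ((-1) ^+ l * (cos x)^-1 ^+ l) *: cosTaylor m x ^+ l.
  by rewrite -!mul_polyC rmorphM !rmorphXn /= polyCN mulrA.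
rewrite coefMn coefZ coef_cosTaylor_expr // /cosPow exprVn.
rewrite -(mulr_natr (_ * _) 'C(k, l)).
have m0 := natr_fact_neq0 R m.
have p0 : 2 ^+ l != 0 :> R by rewrite expf_neq0 // pnatr_eq0.
have cl0 : cos x ^+ l != 0 by rewrite expf_neq0.
by field; apply/and3P; split.
Qed.

Lemma diffSum_eq0 k m x : cos x != 0 -> (m < k)%N -> diffSum k m x = 0.
Proof. by move=> c0 lt_mk; rewrite diffSum_coef // coefXnM lt_mk mulr0. Qed.

Lemma bell_cos k m x : (k <= m)%N -> cos x != 0 ->
  bell m k (fun j => cos (x + j%:R * (pi / 2))) =
  (-1) ^+ k / k`!%:R * cos x ^+ k * diffSum k m x.
Proof.
move=> le_km c0; rewrite bell_coef // diffSum_coef //.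
rewrite (_ : \sum_(q < _) _ = 'X * cosTail (m - k + 1) x).
  2:{ rewrite /cosTail poly_def mulr_sumr; apply: eq_bigr => q _.
      by rewrite exprS [LHS]scalerAr. }
rewrite exprMn !coefXnM ltnNge le_km /=.
have -> : (cosTail (m - k + 1) x ^+ k)`_(m - k) = (cosTail m x ^+ k)`_(m - k).
  (* For [k = 0] both powers are 1. Otherwise m - k < m, so both truncations keep all coefficients
     up to degree m - k. *)
  case: k le_km => [|k] le_km; first by rewrite !expr0.
  apply: coef_expr_agree => i le_i; rewrite !coef_poly addn1 ltnS le_i.
  by rewrite (leq_ltn_trans le_i) // ltn_subrL (leq_trans _ le_km).
have ck0 : cos x ^+ k != 0 by rewrite expf_neq0.
have k0 := natr_fact_neq0 R k.
have sgn2 : (-1) ^+ k * (-1) ^+ k = 1 :> R by rewrite -expr2 sqrr_sign.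
by rewrite (exprNn (cos x)^-1) exprVn; field: sgn2; apply/andP; split.
Qed.

(** * Differentiation in x and the tangent *)

(** Differentiating cos^(-l) brings out l tan x; the identity l C(k+1,l) = (k+1) (C(k+1,l) - C(k,l))
    turns the weight l into a difference of two such sums. *)
Lemma is_derive_diffSum k m x : cos x != 0 ->
  is_derive x 1 (diffSum k.+1 m) (diffSum k.+1 m.+1 x +
    k.+1%:R * tan x * (diffSum k.+1 m x - diffSum k m x)).
Proof.
move=> c0.
pose dh l (t : R) : R := (-1) ^+ l * 'C(k.+1, l)%:R *
  ((cos t ^+ l)^-1 * cosPow l m.+1 t + l%:R * tan t * (cos t ^+ l)^-1 * cosPow l m t).
have dterm l : is_derive x 1 (fun t => (-1) ^+ l * 'C(k.+1, l)%:R *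
    ((cos t ^+ l)^-1 * cosPow l m t)) (dh l x).
  have cl0 : cos x ^+ l != 0 by rewrite expf_neq0.
  have dV : is_derive x 1 (fun t : R => (cos t ^+ l)^-1)
      (l%:R * tan x * (cos x ^+ l)^-1).
    have dX := is_deriveX l (is_derive_cos x); rewrite exprfctE in dX.
    have := @is_deriveV R (fun t => cos t ^+ l) x _ 1 cl0 dX.
    move=> /is_derive_eq; apply; rewrite /GRing.scale /= /tan.
    case: l cl0 {dX} => [|l] cl0; first by rewrite !mul0r mulr0.
    by rewrite /= !exprS expr0; field; rewrite c0 expf_neq0.
  have := is_deriveZ ((-1) ^+ l * 'C(k.+1, l)%:R) (is_deriveM dV (is_derive_cosPow l m x)).
  by move=> /is_derive_eq; apply; rewrite /GRing.scale /= /dh; ring.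
have diffE j n t : diffSum j n t =
    \sum_(0 <= l < j.+1) (-1) ^+ l * 'C(j, l)%:R * ((cos t ^+ l)^-1 * cosPow l n t).
  by apply: eq_bigr => l _; rewrite /cosPow !mul1r !mulrA; ring.
rewrite (_ : diffSum k.+1 m = fun t => \sum_(0 <= l < k.+2) (-1) ^+ l *
    'C(k.+1, l)%:R * ((cos t ^+ l)^-1 * cosPow l m t)).
  2:{ by apply/funext => t; exact: diffE. }
apply: is_derive_eq (is_derive_sum_seq _ dterm) _.
(* A zero term with C(k,k+1) = 0 is appended to give both sums the same range. *)
have -> : diffSum k m x = \sum_(0 <= l < k.+2) (-1) ^+ l * 'C(k, l)%:R *
    ((cos x ^+ l)^-1 * cosPow l m x).
  by rewrite big_nat_recr //= bin_small // mulr0 mul0r addr0 diffE.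
rewrite !diffE -sumrB mulr_sumr -big_split; apply: eq_bigr => l _ /=.
have binE : l%:R * 'C(k.+1, l)%:R = k.+1%:R * ('C(k.+1, l)%:R - 'C(k, l)%:R) :> R.
  case: l => [|l]; first by rewrite !bin0 subrr mulr0 mul0r.
  by rewrite -natrM -mul_bin_diag natrM binS natrD (addrC (_ %:R)) addrK.
by rewrite /dh; ring: binE.
Qed.

(* The m-th derivative of - ln cos, for 0 < m <= n. *)
Definition logDerivSum n m x := \sum_(1 <= k < n.+1) 1 / k%:R * diffSum k m x.

Lemma is_derive_logDerivSum n m x : (0 < m < n)%N -> cos x != 0 ->
  is_derive x 1 (logDerivSum n m) (logDerivSum n m.+1 x).
Proof.
move=> /andP[m_gt0 lt_mn] c0.
rewrite (_ : logDerivSum n m = fun t => \sum_(0 <= k < n) k.+1%:R^-1 * diffSum k.+1 m t).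
  2:{ apply/funext => t; rewrite /logDerivSum big_add1.
      by apply: eq_bigr => k _; rewrite mul1r. }
pose dh k (t : R) : R := k.+1%:R^-1 * (diffSum k.+1 m.+1 t +
  k.+1%:R * tan t * (diffSum k.+1 m t - diffSum k m t)).
have dterm k : is_derive x 1 (fun t => k.+1%:R^-1 * diffSum k.+1 m t) (dh k x).
  exact: is_deriveZ (is_derive_diffSum k m c0).
apply: is_derive_eq (is_derive_sum_seq _ dterm) _.
rewrite /logDerivSum big_add1.
transitivity (\sum_(0 <= k < n) (1 / k.+1%:R * diffSum k.+1 m.+1 x) +
    tan x * \sum_(0 <= k < n) (diffSum k.+1 m x - diffSum k m x)).
  rewrite mulr_sumr -big_split; apply: eq_bigr => k _ /=; rewrite /dh.
  by field; rewrite nat1r pnatr_eq0.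
(* The upper end vanishes because [m < n], the lower one because it is a multiple of 0^m with
   [0 < m]. *)
rewrite telescope_sumr // (diffSum_eq0 c0 lt_mn) sub0r.
rewrite /diffSum big_nat1 /cosSum big_nat1 mulr0 subr0 expr0n gtn_eqF //.
by rewrite !(mulr0, mul0r) oppr0 mulr0 addr0.
Qed.

(** Only k = 1 survives, as [diffSum k 1] vanishes for k > 1. *)
Lemma logDerivSum1 n x : (0 < n)%N -> cos x != 0 -> logDerivSum n 1 x = tan x.
Proof.
move=> n_gt0 c0; rewrite /logDerivSum big_ltn // big_nat big1.
  2:{ by move=> k /andP[lt1k _]; rewrite diffSum_eq0 ?mulr0. }
rewrite addr0 divr1 mul1r /diffSum big_nat_recl // big_nat1.
rewrite /cosSum big_nat1 big_nat_recl // big_nat1.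
have -> : pi / 2 * 1 + (2 * 0 - 1) * x = - x + pi / 2 by ring.
have -> : pi / 2 * 1 + (2 * 1 - 1) * x = x + pi / 2 by ring.
by rewrite !cosDpihalf sinN /tan !bin0 binn; field.
Qed.

End BellCosine.

(** * Translation by pi/2, from cosine to sine *)

Section QuarterShift.
Variable R : realType.
Implicit Types (x : R) (k l m n : nat).

(** Writing - (2q - l) pi/2 as - l pi/2 + (l - q) pi leaves a natural multiple of pi, hence only a
    sign. *)
Let quarter_shift_arg l m q x : (q <= l)%N ->
  pi / 2 * m%:R + (2 * q%:R - l%:R) * (x - pi / 2) =
  (m%:R - l%:R) * (pi / 2) + (2 * q%:R - l%:R) * x + (l - q)%:R * pi.
Proof. by move=> le_ql; rewrite natrB //; field. Qed.

Let sign_subn l q : (q <= l)%N -> (-1) ^+ (l - q) = (-1) ^+ l * (-1) ^+ q :> R.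
Proof. by move=> le_ql; rewrite -signr_odd oddB // signr_addb !signr_odd. Qed.

Lemma cos_quarter_shift l m q x : (q <= l)%N ->
  cos (pi / 2 * m%:R + (2 * q%:R - l%:R) * (x - pi / 2)) =
  (-1) ^+ l * (-1) ^+ q *
    cos ((m%:R - l%:R) * (pi / 2) + (2 * q%:R - l%:R) * x).
Proof.
by move=> le_ql; rewrite quarter_shift_arg // cosDpin sign_subn.
Qed.

Lemma sin_quarter_shift l m q x : (q <= l)%N ->
  sin (pi / 2 * m%:R + (2 * q%:R - l%:R) * (x - pi / 2)) =
  (-1) ^+ l * (-1) ^+ q *
    sin ((m%:R - l%:R) * (pi / 2) + (2 * q%:R - l%:R) * x).
Proof.
by move=> le_ql; rewrite quarter_shift_arg // sinDpin sign_subn.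
Qed.

Lemma cosSum_quarter_shift l m x :
  cosSum l m (x - pi / 2) = (-1) ^+ l *
    \sum_(0 <= q < l.+1) (-1) ^+ q * 'C(l, q)%:R * (2 * q%:R - l%:R) ^+ m *
      cos ((m%:R - l%:R) * (pi / 2) + (2 * q%:R - l%:R) * x).
Proof.
rewrite mulr_sumr; apply: eq_big_nat => q /andP[_ lt_ql].
by rewrite cos_quarter_shift //; ring.
Qed.

(** One quarter turn of the phase is traded for a sine: the power stays [n.+1] while the phase drops
    to n pi/2, as in (iii). *)
Lemma cosSumS l n x :
  cosSum l n.+1 x = - \sum_(0 <= q < l.+1) 'C(l, q)%:R *
    (2 * q%:R - l%:R) ^+ n.+1 * sin (pi / 2 * n%:R + (2 * q%:R - l%:R) * x).
Proof.
rewrite -sumrN; apply: eq_bigr => q _; rewrite -mulrN -cosDpihalf.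
by congr (_ * cos _); rewrite -natr1; ring.
Qed.

Lemma cosSumS_quarter_shift l n x :
  cosSum l n.+1 (x - pi / 2) = - ((-1) ^+ l *
    \sum_(0 <= q < l.+1) (-1) ^+ q * 'C(l, q)%:R *
      (2 * q%:R - l%:R) ^+ n.+1 *
      sin ((n%:R - l%:R) * (pi / 2) + (2 * q%:R - l%:R) * x)).
Proof.
rewrite cosSumS mulr_sumr; congr (- _); apply: eq_big_nat => q /andP[_ lt_ql].
by rewrite sin_quarter_shift //; ring.
Qed.

Lemma sinSum_quarter_shift_eq0 l m x :
  \sum_(0 <= q < l.+1) (-1) ^+ q * 'C(l, q)%:R * (2 * q%:R - l%:R) ^+ m *
    sin ((m%:R - l%:R) * (pi / 2) + (2 * q%:R - l%:R) * x) = 0.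
Proof.
set s := LHS; suff /eqP : (-1) ^+ l * s = 0 by rewrite mulf_eq0 signr_eq0 => /eqP.
rewrite -[RHS](sinSum_eq0 l m (x - pi / 2)) mulr_sumr.
apply: eq_big_nat => q /andP[_ lt_ql]; rewrite sin_quarter_shift //.
by ring.
Qed.

(** * Higher derivatives of the four functions *)

Lemma is_nderive_cos_expr k m x :
  is_nderive (fun t : R => cos t ^+ k) m x (cosPow k m x).
Proof.
apply: (is_nderive_family (U := setT) (F := cosPow k)) => //; first exact: openT.
  by move=> y _; rewrite cosPow_expr.
by move=> i y _ _; exact: is_derive_cosPow.
Qed.

Lemma is_nderive_sin_expr k m x :
  is_nderive (fun t : R => sin t ^+ k) m x (cosPow k m (x - pi / 2)).
Proof.
apply: (is_nderive_family (U := setT)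
  (F := fun i t => cosPow k i (t - pi / 2))) => //; first exact: openT.
  by move=> y _; rewrite cosPow_expr cosBpihalf.
by move=> i y _ _; apply: is_derive_translate; exact: is_derive_cosPow.
Qed.

Lemma open_neq0 (f : R -> R) : continuous f -> open [set x | f x != 0].
Proof.
move=> cf; apply: (@open_comp _ _ f [set y | y != 0]); last exact: open_neq.
by move=> x _; exact: cf.
Qed.

(** The tangent is already a first derivative, of - ln cos, so its i-th derivative has index [i.+1].
    The upper limit [n.+1] stays fixed and exceeds [i.+1] at every step [i < n]. *)
Lemma is_nderive_tan n x : cos x != 0 ->
  is_nderive (fun t : R => tan t) n x (logDerivSum n.+1 n.+1 x).
Proof.
move=> c0; apply: (is_nderive_family (U := [set t | cos t != 0])
  (F := fun i => logDerivSum n.+1 i.+1)) => //.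
- exact: open_neq0 (@continuous_cos R).
- by move=> y cy0; rewrite logDerivSum1.
- by move=> i y lt_in cy0; apply: is_derive_logDerivSum.
Qed.

(** This is the tangent case through cot t = - tan (t - pi/2). *)
Lemma is_nderive_cot n x : sin x != 0 ->
  is_nderive (fun t : R => cot t) n x (- logDerivSum n.+1 n.+1 (x - pi / 2)).
Proof.
move=> s0; apply: (is_nderive_family (U := [set t | sin t != 0])
  (F := fun i t => - logDerivSum n.+1 i.+1 (t - pi / 2))) => //.
- exact: open_neq0 (@continuous_sin R).
- move=> y sy0; rewrite logDerivSum1 ?cosBpihalf // /tan sinBpihalf cosBpihalf.
  by rewrite mulNr opprK.
- move=> i y lt_in sy0; apply: is_deriveN; apply: is_derive_translate.
  by apply: is_derive_logDerivSum; rewrite ?cosBpihalf.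
Qed.

End QuarterShift.

(** * The formulas in their explicit form *)

Theorem theorem1p2 (R : realType) :
  (forall (k m : nat) (x : R), (k, m) <> (0%N, 0%N) ->
    [/\ is_nderive (fun t : R => sin t ^+ k) m x
          ((-1) ^+ k / 2 ^+ k *
           \sum_(0 <= q < k.+1) (-1) ^+ q * 'C(k, q)%:R *
             (2 * q%:R - k%:R) ^+ m *
             cos ((m%:R - k%:R) * (pi / 2) + (2 * q%:R - k%:R) * x)),
        is_nderive (fun t : R => cos t ^+ k) m x
          (1 / 2 ^+ k *
           \sum_(0 <= q < k.+1) 'C(k, q)%:R *
             (2 * q%:R - k%:R) ^+ m *
             cos (pi / 2 * m%:R + (2 * q%:R - k%:R) * x)),
        \sum_(0 <= q < k.+1) (-1) ^+ q * 'C(k, q)%:R *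
          (2 * q%:R - k%:R) ^+ m *
          sin ((m%:R - k%:R) * (pi / 2) + (2 * q%:R - k%:R) * x) = 0 &
        \sum_(0 <= q < k.+1) 'C(k, q)%:R *
          (2 * q%:R - k%:R) ^+ m *
          sin (pi / 2 * m%:R + (2 * q%:R - k%:R) * x) = 0])
  /\
  (forall (k m : nat), (1 <= k)%N -> (k <= m)%N ->
    (forall x : R, cos x <> 0 ->
      bell m k (fun j : nat => cos (x + j%:R * (pi / 2))) =
        (-1) ^+ k / (k`!)%:R * cos x ^+ k *
        \sum_(0 <= l < k.+1) (-1) ^+ l / 2 ^+ l * 'C(k, l)%:R *
          (1 / cos x ^+ l) *
          \sum_(0 <= q < l.+1) 'C(l, q)%:R *
            (2 * q%:R - l%:R) ^+ m *
            cos (pi / 2 * m%:R + (2 * q%:R - l%:R) * x))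
    /\
    (forall x : R, sin x <> 0 ->
      bell m k (fun j : nat => sin (x + j%:R * (pi / 2))) =
        (-1) ^+ k / (k`!)%:R * sin x ^+ k *
        \sum_(0 <= l < k.+1) 1 / 2 ^+ l * 'C(k, l)%:R *
          (1 / sin x ^+ l) *
          \sum_(0 <= q < l.+1) (-1) ^+ q * 'C(l, q)%:R *
            (2 * q%:R - l%:R) ^+ m *
            cos ((m%:R - l%:R) * (pi / 2) + (2 * q%:R - l%:R) * x)))
  /\
  (forall n : nat, (1 <= n)%N ->
    (forall x : R, cos x <> 0 ->
      is_nderive (fun t : R => tan t) n x
        (- \sum_(1 <= k < n.+2) 1 / k%:R *
           \sum_(0 <= l < k.+1) (-1) ^+ l / 2 ^+ l * 'C(k, l)%:R *
             (1 / cos x ^+ l) *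
             \sum_(0 <= q < l.+1) 'C(l, q)%:R *
               (2 * q%:R - l%:R) ^+ n.+1 *
               sin (pi / 2 * n%:R + (2 * q%:R - l%:R) * x)))
    /\
    (forall x : R, sin x <> 0 ->
      is_nderive (fun t : R => cot t) n x
        (\sum_(1 <= k < n.+2) 1 / k%:R *
           \sum_(0 <= l < k.+1) 1 / 2 ^+ l * 'C(k, l)%:R *
             (1 / sin x ^+ l) *
             \sum_(0 <= q < l.+1) (-1) ^+ q * 'C(l, q)%:R *
               (2 * q%:R - l%:R) ^+ n.+1 *
               sin ((n%:R - l%:R) * (pi / 2) + (2 * q%:R - l%:R) * x)))).
Proof.
split.
  move=> k m x _; split.
  - rewrite [X in is_nderive _ _ _ X](_ : _ = cosPow k m (x - pi / 2)).
      exact: is_nderive_sin_expr.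
    by rewrite /cosPow cosSum_quarter_shift; ring.
  - exact: is_nderive_cos_expr.
  - exact: sinSum_quarter_shift_eq0.
  - exact: sinSum_eq0.
split=> [k m k_gt0 le_km|n n_gt0]; split=> x /eqP x0.
- exact: bell_cos.
- rewrite (_ : (fun j : nat => _) =
      fun j : nat => cos (x - pi / 2 + j%:R * (pi / 2))).
    2:{ by apply/funext => j; rewrite addrAC cosBpihalf. }
  rewrite bell_cos ?cosBpihalf //; congr (_ * _); apply: eq_bigr => l _.
  rewrite cosSum_quarter_shift cosBpihalf.
  (* The sign (-1)^l from the translation cancels the one in [diffSum]. *)
  have sgn2 : (-1) ^+ l * (-1) ^+ l = 1 :> R by rewrite -expr2 sqrr_sign.
  by ring: sgn2.
- rewrite [X in is_nderive _ _ _ X](_ : _ = logDerivSum n.+1 n.+1 x).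
    exact: is_nderive_tan.
  rewrite -sumrN; apply: eq_bigr => k _; rewrite -mulrN -sumrN; congr (_ * _).
  by apply: eq_bigr => l _; rewrite cosSumS mulrN.
- rewrite [X in is_nderive _ _ _ X](_ : _ = - logDerivSum n.+1 n.+1 (x - pi / 2)).
    exact: is_nderive_cot.
  (* The outer minus sign cancels the one that comes from replacing cosine by sine. *)
  rewrite -sumrN; apply: eq_bigr => k _; rewrite -mulrN -sumrN; congr (_ * _).
  apply: eq_bigr => l _; rewrite cosSumS_quarter_shift cosBpihalf.
  have sgn2 : (-1) ^+ l * (-1) ^+ l = 1 :> R by rewrite -expr2 sqrr_sign.
  by ring: sgn2.
Qed.
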